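(* For a set $\mathcal{I}\subseteq\{k,i,c,\wedge,\vee\}$ of operations, a topological space $X$ and a subset $E\subseteq X$, let $G_{\mathcal{I}}(X;E)$ be the family of subsets of $X$ that can be obtained from $E$ by finitely many (possibly zero) successive applications of the operations in $\mathcal{I}$, i.e. the smallest family of subsets of $X$ that contains $E$ and is closed under the operations in $\mathcal{I}$. Let $M(\mathcal{I})$ be the maximum of $|G_{\mathcal{I}}(X;E)|$ over all topological spaces $X$ and all $E\subseteq X$, where $M(\mathcal{I})=\infty$ means that $G_{\mathcal{I}}(X;E)$ is infinite for some $X$ and $E$. Let $\mathcal{F}$ be the free closure algebra on one generator, and let $(\mathcal{I})_{\mathcal{F}}$ be the smallest subset of $\mathcal{F}$ containing the generator and closed under the operations in $\mathcal{I}$. Then for every $\mathcal{I}\subseteq\{k,i,c,\wedge,\vee\}$ one has $M(\mathcal{I})=|(\mathcal{I})_{\mathcal{F}}|$ (with $\infty$ meaning infinite cardinality), and, writing $\mathcal{I}=U\cup B$ with $U\subseteq\{k,i,c\}$ and $B\subseteq\{\wedge,\vee\}$, the value is as follows, where the four numbers in each row correspond to $B=\emptyset$, $B=\{\wedge\}$, $B=\{\vee\}$, $B=\{\wedge,\vee\}$ in this order: \begin{itemize} \item $U=\emptyset$: $1,\ 1,\ 1,\ 1$; \item $U=\{i\}$: $2,\ 2,\ 2,\ 2$; \item $U=\{k\}$: $2,\ 2,\ 2,\ 2$; \item $U=\{c\}$: $2,\ 4,\ 4,\ 4$; \item $U=\{i,k\}$: $7,\ 13,\ 13,\ 35$; \item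 $U=\{i,c\}$, $U=\{k,c\}$, or $U=\{i,k,c\}$: $14,\ \infty,\ \infty,\ \infty$. \end{itemize} In particular, the maximum number of distinct sets that can be generated from one set in a topological space by closures, interiors and intersections is $13$, and by closures, interiors, intersections and unions it is $35$.
   Context: For a topological space $X$, the operations on subsets of $X$ are: $k$ = topological closure, $i$ = topological interior, $c$ = set complement in $X$ (unary operations), and $\wedge$ = intersection of two sets, $\vee$ = union of two sets (binary operations). A closure algebra is a Boolean lattice (complemented distributive lattice) with join $\vee$, meet $\wedge$, complement $c$, least element $0$ and greatest element $1$, equipped with a unary operation $k$ satisfying $k0=0$, $kkx=kx$, $kx\ge x$, and $kx\vee ky=k(x\vee y)$ for all $x,y$; one sets $i=ckc$. The power set of a topological space is a closure algebra with the operations above. The free closure algebra on one generator $\mathcal{F}$ is the free object on one generator in the class of all closure algebras (a single generator $F$ such that for each closure algebra $A$ and each $a\in A$ there is a unique homomorphism of closure algebras $\mathcal{F}\to A$ sending $F$ to $a$). *)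

(* Defs.v *)
From HB Require Import structures.
From mathcomp Require Import all_boot all_order.
From mathcomp Require Import all_classical.
From mathcomp Require Import topology_structure.

Set Implicit Arguments.
Unset Strict Implicit.
Unset Printing Implicit Defensive.

Import Order.Theory.
Local Open Scope classical_set_scope.
Local Open Scope card_scope.

(* [ctbDistrLatticeType] is the type of Boolean lattices; the degenerate one,
   with bottom = top, is allowed (it is the power set of the empty space). *)
HB.mixin Record hasClosureOperator d T of Order.CTBDistrLattice d T := {
  clo : T -> T;
  clo0 : (clo \bot = \bot :> T)%O;
  clo_clo : forall x : T, clo (clo x) = clo x;
  le_clo : forall x : T, (x <= clo x)%O;
  cloU : forall x y : T, (clo x `|` clo y = clo (x `|` y))%O
}.

#[short(type="closureAlgType")]
HB.structure Definition ClosureAlgebra d :=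
  { T of hasClosureOperator d T & Order.CTBDistrLattice d T }.

Definition alg_int d (A : closureAlgType d) (x : A) : A :=
  (~` clo (~` x))%O.

HB.instance Definition _ (X : topologicalType) :=
  hasClosureOperator.Build set_display (set X)
    (@closure0 X)
    (fun E => esym (proj1 (closure_id (closure E)) (@closed_closure X E)))
    (fun E => introT (asboolP _) (@subset_closure X E))
    (fun E1 E2 => esym (@closureU X E1 E2)).

Record is_closure_hom d1 (A : closureAlgType d1) d2 (B : closureAlgType d2)
    (h : A -> B) : Prop := IsClosureHom {
  hom_bot : (h \bot = \bot)%O;
  hom_top : (h \top = \top)%O;
  hom_meet : forall x y, (h (x `&` y) = h x `&` h y)%O;
  hom_join : forall x y, (h (x `|` y) = h x `|` h y)%O;
  hom_compl : forall x, (h (~` x) = ~` h x)%O;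
  hom_clo : forall x, h (clo x) = clo (h x)
}.

Definition is_free1 d (F : closureAlgType d) (f : F) : Prop :=
  forall (d' : Order.disp_t) (A : closureAlgType d') (a : A),
    exists! h : F -> A, is_closure_hom h /\ h f = a.

Variant operation : Set := Op_k | Op_i | Op_c | Op_meet | Op_join.

Record closed_under T (k i c : T -> T) (meet join : T -> T -> T)
    (I : set operation) (S : set T) : Prop := ClosedUnder {
  closed_k : I Op_k -> forall x, S x -> S (k x);
  closed_i : I Op_i -> forall x, S x -> S (i x);
  closed_c : I Op_c -> forall x, S x -> S (c x);
  closed_meet : I Op_meet -> forall x y, S x -> S y -> S (meet x y);
  closed_join : I Op_join -> forall x y, S x -> S y -> S (join x y)
}.

Definition top_gen (I : set operation) (X : topologicalType) (E : set X) :
    set (set X) :=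
  smallest (closed_under (@closure X) (@interior X) (@setC X)
                         (@setI X) (@setU X) I) [set E].

Definition alg_gen (I : set operation) d (A : closureAlgType d) (a : A) :
    set A :=
  smallest (closed_under (@clo d A) (@alg_int d A) (@Order.compl d A)
                         (@Order.meet d A) (@Order.join d A) I) [set a].

(* Finite cardinals together with a single infinite value. *)
Variant ecard : Set := Fin of nat | Infty.
Coercion Fin : nat >-> ecard.

Definition has_ecard T (S : set T) (m : ecard) : Prop :=
  match m with
  | Fin n => S #= `I_n
  | Infty => infinite_set S
  end.

(* [is_max_gen I m] means M(I) = m.  It is a relation because M(I) is not
   defined a priori: there could be no bound on finite families. *)
Definition is_max_gen (I : set operation) (m : ecard) : Prop :=
  match m with
  | Fin n =>
      (forall (X : topologicalType) (E : set X), top_gen I E #<= `I_n) /\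
      (exists (X : topologicalType) (E : set X), top_gen I E #= `I_n)
  | Infty =>
      exists (X : topologicalType) (E : set X), infinite_set (top_gen I E)
  end.

Definition table_row (U : set operation) (m0 m1 m2 m3 : ecard) : Prop :=
  [/\ is_max_gen U m0,
      is_max_gen (U `|` [set Op_meet]) m1,
      is_max_gen (U `|` [set Op_join]) m2 &
      is_max_gen (U `|` [set Op_meet; Op_join]) m3].

(* Existence of a free closure algebra on one generator: terms modulo
   equality of their values in all closure algebras. *)

Inductive term : Set :=
  | Tvar | Tbot | Ttop
  | Tmeet of term & term | Tjoin of term & term
  | Tcompl of term | Tclo of term.

HB.instance Definition _ := gen_eqMixin term.
HB.instance Definition _ := gen_choiceMixin term.

Fixpoint teval d (A : closureAlgType d) (a : A) (t : term) : A :=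
  match t with
  | Tvar => a
  | Tbot => \bot%O
  | Ttop => \top%O
  | Tmeet t u => (teval a t `&` teval a u)%O
  | Tjoin t u => (teval a t `|` teval a u)%O
  | Tcompl t => (~` teval a t)%O
  | Tclo t => clo (teval a t)
  end.

Definition teqv (t u : term) : Prop :=
  forall d (A : closureAlgType d) (a : A), teval a t = teval a u.

Definition free_norm (t : term) : term := xget Tbot [set u | teqv t u].

Lemma free_normP t : teqv t (free_norm t).
Proof. by apply: (@xgetPex _ Tbot [set u | teqv t u]); exists t. Qed.

Lemma free_norm_eq t u : teqv t u -> free_norm t = free_norm u.
Proof.
move=> tu; rewrite /free_norm; congr xget; apply/seteqP.
by split=> v /= H d A a; [rewrite -tu | rewrite tu].
Qed.

Record free_alg : Set := FreeAlg {
  free_term : term;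
  _ : free_norm free_term == free_term
}.

HB.instance Definition _ := [isSub for free_term].
HB.instance Definition _ := [Choice of free_alg by <:].

Lemma free_norm_id t : free_norm (free_norm t) == free_norm t.
Proof. by apply/eqP/esym/free_norm_eq/free_normP. Qed.

Definition free_class (t : term) : free_alg := FreeAlg (free_norm_id t).

Definition feval d (A : closureAlgType d) (a : A) (x : free_alg) : A :=
  teval a (free_term x).

Lemma feval_class d (A : closureAlgType d) (a : A) t :
  feval a (free_class t) = teval a t.
Proof. exact/esym/free_normP. Qed.

Lemma feval_inj (x y : free_alg) :
  (forall d (A : closureAlgType d) (a : A), feval a x = feval a y) -> x = y.
Proof.
move=> xy; apply: val_inj; rewrite /= -(eqP (valP x)) -(eqP (valP y)).
exact: free_norm_eq.
Qed.

Definition free_bot := free_class Tbot.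
Definition free_top := free_class Ttop.
Definition free_meet (x y : free_alg) :=
  free_class (Tmeet (free_term x) (free_term y)).
Definition free_join (x y : free_alg) :=
  free_class (Tjoin (free_term x) (free_term y)).
Definition free_compl (x : free_alg) := free_class (Tcompl (free_term x)).
Definition free_clo (x : free_alg) := free_class (Tclo (free_term x)).

Lemma fevalE d (A : closureAlgType d) (a : A) :
  (feval a free_bot = \bot%O) * (feval a free_top = \top%O) *
  (forall x y, feval a (free_meet x y) = (feval a x `&` feval a y)%O) *
  (forall x y, feval a (free_join x y) = (feval a x `|` feval a y)%O) *
  (forall x, feval a (free_compl x) = (~` feval a x)%O) *
  (forall x, feval a (free_clo x) = clo (feval a x)).
Proof. by do !split; move=> *; rewrite feval_class. Qed.

Ltac free_law := repeat intro; apply: feval_inj => ? ? ?; rewrite !fevalE.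

Fact free_meetC : commutative free_meet.
Proof. by free_law; rewrite meetC. Qed.
Fact free_joinC : commutative free_join.
Proof. by free_law; rewrite joinC. Qed.
Fact free_meetA : associative free_meet.
Proof. by free_law; rewrite meetA. Qed.
Fact free_joinA : associative free_join.
Proof. by free_law; rewrite joinA. Qed.
Fact free_joinKI (y x : free_alg) : free_meet x (free_join x y) = x.
Proof. by free_law; rewrite joinKI. Qed.
Fact free_meetKU (y x : free_alg) : free_join x (free_meet x y) = x.
Proof. by free_law; rewrite meetKU. Qed.
Fact free_meetUl : left_distributive free_meet free_join.
Proof. by free_law; rewrite meetUl. Qed.
Fact free_meetxx : idempotent_op free_meet.
Proof. by free_law; rewrite meetxx. Qed.

Fact free_display : Order.disp_t.
Proof. exact: Order.Disp tt tt. Qed.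

HB.instance Definition _ :=
  Order.isMeetJoinDistrLattice.Build free_display free_alg
    (fun _ _ => erefl) (fun _ _ => erefl)
    free_meetC free_joinC free_meetA free_joinA
    free_joinKI free_meetKU free_meetUl free_meetxx.

Fact free_le0x (x : free_alg) : (free_bot <= x)%O.
Proof. by apply/eqP; free_law; rewrite meet0x. Qed.
Fact free_lex1 (x : free_alg) : (x <= free_top)%O.
Proof. by apply/eqP; free_law; rewrite meetx1. Qed.

HB.instance Definition _ :=
  Order.hasBottom.Build free_display free_alg free_le0x.
HB.instance Definition _ :=
  Order.hasTop.Build free_display free_alg free_lex1.

Fact free_joinxC (x : free_alg) : (x `|` free_compl x)%O = \top%O.
Proof. by free_law; rewrite joinxC. Qed.
Fact free_meetxC (x : free_alg) : (x `&` free_compl x)%O = \bot%O.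
Proof. by free_law; rewrite meetxC. Qed.

HB.instance Definition _ :=
  Order.TBDistrLattice_hasComplement.Build free_display free_alg
    free_joinxC free_meetxC.

Fact free_clo0 : free_clo \bot%O = \bot%O.
Proof. by free_law; rewrite clo0. Qed.
Fact free_clo_clo (x : free_alg) : free_clo (free_clo x) = free_clo x.
Proof. by free_law; rewrite clo_clo. Qed.
Fact free_le_clo (x : free_alg) : (x <= free_clo x)%O.
Proof.
by apply/eqP; free_law; rewrite (meet_l (le_clo _)).
Qed.
Fact free_cloU (x y : free_alg) :
  (free_clo x `|` free_clo y)%O = free_clo (x `|` y)%O.
Proof. by free_law; rewrite cloU. Qed.

HB.instance Definition _ :=
  hasClosureOperator.Build free_display free_alg
    free_clo0 free_clo_clo free_le_clo free_cloU.

Lemma free_alg_is_free1 : is_free1 (free_class Tvar).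
Proof.
move=> d A a; exists (feval a); split.
  split; last by rewrite feval_class.
  by split => *; rewrite fevalE.
move=> h [hh ha]; apply/funext => x.
suff H t : h (free_class t) = teval a t.
  by rewrite /feval -H; congr h; apply: feval_inj => *; rewrite feval_class.
elim: t => [||| t IHt u IHu | t IHt u IHu | t IHt | t IHt] /=.
- by [].
- exact: hom_bot hh.
- exact: hom_top hh.
- rewrite -IHt -IHu -(hom_meet hh); congr h.
  by apply: feval_inj => *; rewrite fevalE !feval_class.
- rewrite -IHt -IHu -(hom_join hh); congr h.
  by apply: feval_inj => *; rewrite fevalE !feval_class.
- rewrite -IHt -(hom_compl hh); congr h.
  by apply: feval_inj => *; rewrite fevalE !feval_class.
- rewrite -IHt -(hom_clo hh); congr h.
  by apply: feval_inj => *; rewrite fevalE !feval_class.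
Qed.

(* Main.v *)
Require Import Defs.
From HB Require Import structures.
From mathcomp Require Import all_boot all_order.
From mathcomp Require Import all_classical.
From mathcomp Require Import topology_structure.

Set Implicit Arguments.
Unset Strict Implicit.
Unset Printing Implicit Defensive.

Import Order.Theory.
Local Open Scope classical_set_scope.
Local Open Scope card_scope.

(** The number of sets generated from one set is governed by two bounds: an
upper bound that holds in every closure algebra, and a space in which it is
attained.  A homomorphism maps the elements generated by [a] onto those
generated by its image ([generated_image]); hence the free closure algebra,
which is a closure algebra and maps onto the subalgebra generated by any subset
of any space, is caught between the two bounds ([max_genP]).

Upper bounds.  Without complements, let [a] be the generator and let [L] be the
eight elements [i a], [i k i a], [k i a /\ i k a], [k i a], [i k a],
[k i a \/ i k a], [k i k a], [k a].  They form a lattice, a chain except for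
the pair [k i a], [i k a]; it is stable under interior and closure.  Everything generated
is of the form [p \/ (q /\ a)] with [p <= q] in [L]; there would be 36 such
pairs in a chain of eight elements, and there are 35 of them in [L].  These
intervals are stable under meet and join, computed endpoint by endpoint,
because the lattice is distributive.  The crux is that interior and closure see
only one endpoint: [i (p \/ (q /\ a)) = i p] and [k (p \/ (q /\ a)) = k q]
([interval_val_int], [interval_val_clo]), by the inequality
[i (x \/ y) <= k x \/ i y] and its dual.  With complements, but without meet and join, one gets
the seven Kuratowski elements and their complements; with complements but
neither interior nor closure, the four elements of a free Boolean algebra.  In
each case the elements are denoted by finitely many codes, and the codes
reachable by the given operations are counted by computation.

Attainment.  One finite space serves for all finite values.  It is the topology
of a preorder on 14 points ([up_points]): for each of the six steps of a maximal
chain in [L] there is a point inside the set and a point outside, which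
separates all the pairs [(p, q)]; of the two other points one is interior to the
set and the other exterior to its closure.

Infinite values.  A complement together with interior or closure, and with meet
or join, yields all operations.  On the natural numbers with the up-sets
[[n, oo)] as closed sets, the odd numbers generate every [[n, oo)]: the closure
of the points of [[n, oo)] whose parity differs from that of [n] is
[[n + 1, oo)]. *)

(** * Sets generated by a family of operations *)

(** Bundling the five operations lets algebras of codes, whose operations are
computable, be related to closure algebras by the same lemmas. *)
Record op_system (T : Type) := OpSystem {
  op_k : T -> T; op_i : T -> T; op_c : T -> T;
  op_meet : T -> T -> T; op_join : T -> T -> T }.

Definition op_closed T (P : op_system T) (I : set operation) :=
  closed_under (op_k P) (op_i P) (op_c P) (op_meet P) (op_join P) I.

Definition generated T (P : op_system T) (I : set operation) (x : T) : set T :=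
  smallest (op_closed P I) [set x].

Definition alg_ops d (A : closureAlgType d) : op_system A :=
  OpSystem (@clo d A) (@alg_int d A) (@Order.compl d A)
    (@Order.meet d A) (@Order.join d A).
Arguments alg_ops {d} A.

Lemma generated_self T (P : op_system T) I x : generated P I x x.
Proof. exact: (@sub_gen_smallest _ (op_closed P I) [set x]). Qed.
Arguments generated_self {T} P I x.

Lemma generated_closed T (P : op_system T) I x :
  op_closed P I (generated P I x).
Proof.
split=> [Io y gy|Io y gy|Io y gy|Io y z gy gz|Io y z gy gz] S [cS xS].
- exact: (closed_k cS Io) (gy S (conj cS xS)).
- exact: (closed_i cS Io) (gy S (conj cS xS)).
- exact: (closed_c cS Io) (gy S (conj cS xS)).
- exact: (closed_meet cS Io) (gy S (conj cS xS)) (gz S (conj cS xS)).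
- exact: (closed_join cS Io) (gy S (conj cS xS)) (gz S (conj cS xS)).
Qed.
Arguments generated_closed {T} P I x.

Lemma generated_min T (P : op_system T) I x (S : set T) :
  op_closed P I S -> S x -> generated P I x `<=` S.
Proof. by move=> cS Sx; apply: smallest_sub => // _ ->. Qed.

(** Compatibility is required only for the operations in [I] and for arguments
in [S]: codes denote elements faithfully only under such restrictions. *)
Record op_morphism_on T U (P : op_system T) (Q : op_system U)
    (I : set operation) (S : set T) (h : T -> U) : Prop := OpMorphismOn {
  morph_k : I Op_k -> forall x, S x -> h (op_k P x) = op_k Q (h x);
  morph_i : I Op_i -> forall x, S x -> h (op_i P x) = op_i Q (h x);
  morph_c : I Op_c -> forall x, S x -> h (op_c P x) = op_c Q (h x);
  morph_meet : I Op_meet ->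
    forall x y, S x -> S y -> h (op_meet P x y) = op_meet Q (h x) (h y);
  morph_join : I Op_join ->
    forall x y, S x -> S y -> h (op_join P x y) = op_join Q (h x) (h y) }.

(** The image is closed under the operations and the preimage of a closed family
is closed, so each of the two sets contains the other. *)
Lemma generated_image T U (P : op_system T) (Q : op_system U) I x (h : T -> U) :
  op_morphism_on P Q I (generated P I x) h ->
  generated Q I (h x) = h @` generated P I x.
Proof.
move=> hm; have gP := generated_closed P I x; apply/seteqP; split.
  apply: generated_min; last by exists x => //; exact: generated_self.
  split=> [Io _ [y gy <-]|Io _ [y gy <-]|Io _ [y gy <-]
          |Io _ _ [y gy <-] [z gz <-]|Io _ _ [y gy <-] [z gz <-]].
  - rewrite -(morph_k hm Io gy); exists (op_k P y) => //.
    exact: (closed_k gP Io gy).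
  - rewrite -(morph_i hm Io gy); exists (op_i P y) => //.
    exact: (closed_i gP Io gy).
  - rewrite -(morph_c hm Io gy); exists (op_c P y) => //.
    exact: (closed_c gP Io gy).
  - rewrite -(morph_meet hm Io gy gz).
    by exists (op_meet P y z) => //; exact: (closed_meet gP Io gy gz).
  - rewrite -(morph_join hm Io gy gz).
    by exists (op_join P y z) => //; exact: (closed_join gP Io gy gz).
have gQ := generated_closed Q I (h x).
suff : generated P I x `<=` generated P I x `&` h @^-1` generated Q I (h x).
  by move=> sub _ [y /sub[_ gy] <-].
apply: generated_min; last by split; apply: generated_self.
split=> [Io y [gy hy]|Io y [gy hy]|Io y [gy hy]
        |Io y z [gy hy] [gz hz]|Io y z [gy hy] [gz hz]]; split => /=.
- exact: (closed_k gP Io gy).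
- by rewrite (morph_k hm Io gy); exact: (closed_k gQ Io hy).
- exact: (closed_i gP Io gy).
- by rewrite (morph_i hm Io gy); exact: (closed_i gQ Io hy).
- exact: (closed_c gP Io gy).
- by rewrite (morph_c hm Io gy); exact: (closed_c gQ Io hy).
- exact: (closed_meet gP Io gy gz).
- by rewrite (morph_meet hm Io gy gz); exact: (closed_meet gQ Io hy hz).
- exact: (closed_join gP Io gy gz).
- by rewrite (morph_join hm Io gy gz); exact: (closed_join gQ Io hy hz).
Qed.

Lemma alg_genE I d (A : closureAlgType d) (a : A) :
  alg_gen I a = generated (alg_ops A) I a.
Proof. by []. Qed.

(** Interior is a primitive operation in a space and a derived one in an
algebra; they agree on power sets, so that spaces are a case of algebras. *)
Lemma alg_int_set (X : topologicalType) (E : set X) :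
  alg_int (E : set X) = interior E.
Proof.
have -> : alg_int (E : set X) = ~` closure (~` E) by [].
by rewrite closure_setC setCK.
Qed.

Lemma top_genE I (X : topologicalType) (E : set X) :
  top_gen I E = generated (alg_ops (set X)) I E.
Proof.
rewrite /generated /op_closed /=.
by have -> : @alg_int _ (set X) = @interior X by apply/funext/alg_int_set.
Qed.

Definition opset (k i c m j : bool) : pred operation := fun o =>
  match o with
  | Op_k => k | Op_i => i | Op_c => c | Op_meet => m | Op_join => j
  end.

(** * Computing finite generated sets by saturation *)

Lemma card_le_seq (T : eqType) (s : seq T) : [set` s] #<= `I_(size s).
Proof.
case: s => [|x0 s]; first by rewrite set_nil card_ge0.
apply: card_le_trans (card_image_le (nth x0 (x0 :: s)) _).
by apply: subset_card_le => x /= /(nthP x0)[i li <-]; exists i.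
Qed.

Lemma card_eq_seq (T : eqType) (s : seq T) : uniq s -> [set` s] #= `I_(size s).
Proof.
case: s => [|x0 s] us; first by rewrite set_nil II0.
have -> : [set` x0 :: s] = nth x0 (x0 :: s) @` `I_(size s).+1.
  apply/seteqP; split=> [x /= /(nthP x0)[i li <-]|_ [i /= li <-]].
    by exists i.
  exact: mem_nth.
by apply: inj_card_eq => i j /set_mem li /set_mem lj; apply: (uniqP x0 us).
Qed.

(** Adjoining one element at a time keeps the list short: removing duplicates
only after all products have been listed would be quadratic in their number. *)
Definition adjoin (T : eqType) (s : seq T) (y : T) : seq T :=
  if y \in s then s else y :: s.

Lemma mem_adjoin_all (T : eqType) (s t : seq T) z :
  (z \in foldl (@adjoin T) s t) = (z \in s) || (z \in t).
Proof.
elim: t s => [|y t IHt] s /=; first by rewrite orbF.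
rewrite IHt inE orbA; congr orb; rewrite /adjoin.
by case: ifP => [ys|_]; rewrite ?inE orbC //; case: eqP => // ->.
Qed.

Lemma uniq_adjoin_all (T : eqType) (s t : seq T) :
  uniq s -> uniq (foldl (@adjoin T) s t).
Proof.
elim: t s => //= y t IHt s us; apply: IHt; rewrite /adjoin.
by case: ifP => //= ->.
Qed.

Section Saturation.
Variables (T : eqType) (P : op_system T) (J : pred operation).

Definition saturation_step (s : seq T) : seq T := foldl (@adjoin T) s
  ((if J Op_k then map (op_k P) s else [::])
  ++ (if J Op_i then map (op_i P) s else [::])
  ++ (if J Op_c then map (op_c P) s else [::])
  ++ (if J Op_meet then allpairs (op_meet P) s s else [::])
  ++ (if J Op_join then allpairs (op_join P) s s else [::])).

Definition saturation n (x : T) := iter n saturation_step [:: x].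

(** A round that adds nothing certifies that the list is the generated set. *)
Lemma generated_saturation n x :
  all [in saturation n x] (saturation_step (saturation n x)) ->
  generated P [set o | J o] x = [set` saturation n x].
Proof.
move=> /allP sat; apply/seteqP; split.
  apply: generated_min; last first.
    rewrite /=; elim: n {sat} => [|n IHn]; first by rewrite inE.
    by rewrite /saturation iterS mem_adjoin_all IHn.
  split=> Jo => [y sy|y sy|y sy|y z sy sz|y z sy sz] /=; apply: sat;
    rewrite mem_adjoin_all !mem_cat; rewrite /= in Jo; rewrite Jo.
  - by rewrite map_f ?orbT.
  - by rewrite map_f ?orbT.
  - by rewrite map_f ?orbT.
  - by rewrite allpairs_f ?orbT.
  - by rewrite allpairs_f ?orbT.
elim: n {sat} => [y|n IHn y] /=.
  by rewrite inE => /eqP ->; exact: generated_self.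
have gP := generated_closed P [set o | J o] x.
rewrite mem_adjoin_all !mem_cat => /or4P[/IHn//|||/or3P[]].
- by case: ifP => // Jo /mapP[z /IHn gz ->]; exact: (closed_k gP Jo gz).
- by case: ifP => // Jo /mapP[z /IHn gz ->]; exact: (closed_i gP Jo gz).
- by case: ifP => // Jo /mapP[z /IHn gz ->]; exact: (closed_c gP Jo gz).
- case: ifP => // Jo /allpairsP[[z t] [/IHn gz /IHn gt ->]].
  exact: (closed_meet gP Jo gz gt).
- case: ifP => // Jo /allpairsP[[z t] [/IHn gz /IHn gt ->]].
  exact: (closed_join gP Jo gz gt).
Qed.

End Saturation.

Lemma uniq_saturation (T : eqType) (P : op_system T) J n x :
  uniq (saturation P J n x).
Proof. by elim: n => //= n; exact: uniq_adjoin_all. Qed.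

(** * Interior and closure in closure algebras *)

Section ClosureAlgebraTheory.
Context d (A : closureAlgType d).
Implicit Types x y p q a : A.
Local Open Scope order_scope.

Lemma clo_mono x y : x <= y -> clo x <= clo y.
Proof. by rewrite leEjoin => /eqP <-; rewrite -cloU leUl. Qed.

Lemma compl_clo x : ~` clo x = alg_int (~` x).
Proof. by rewrite /alg_int complK. Qed.

Lemma compl_int x : ~` alg_int x = clo (~` x).
Proof. by rewrite /alg_int complK. Qed.

Lemma int_le x : alg_int x <= x.
Proof. by rewrite -leC compl_int le_clo. Qed.

Lemma int_mono x y : x <= y -> alg_int x <= alg_int y.
Proof. by move=> xy; rewrite leC clo_mono // leC. Qed.

Lemma int_int x : alg_int (alg_int x) = alg_int x.
Proof. by rewrite {1}/alg_int compl_int clo_clo. Qed.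

Lemma intI x y : alg_int (x `&` y) = alg_int x `&` alg_int y.
Proof. by rewrite /alg_int complI -cloU complU. Qed.

Lemma clo_int_clo_int x : clo (alg_int (clo (alg_int x))) = clo (alg_int x).
Proof.
apply/le_anti/andP; split.
  by rewrite -{2}[clo (alg_int x)]clo_clo clo_mono // int_le.
by rewrite clo_mono // -{1}int_int int_mono // le_clo.
Qed.

Lemma int_clo_int_clo x : alg_int (clo (alg_int (clo x))) = alg_int (clo x).
Proof.
apply/le_anti/andP; split.
  by rewrite int_mono // -{2}[clo x]clo_clo clo_mono // int_le.
by rewrite -{1}int_int int_mono // le_clo.
Qed.

(** A point of the interior of [x \/ y] outside the closed [clo x] has a
neighbourhood that avoids [x], hence lies in [y]. *)
Lemma int_join_le x y : alg_int (x `|` y) <= clo x `|` alg_int y.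
Proof.
rewrite -leBLR diffE compl_clo -intI int_mono //.
by rewrite meetUl meetxC join0x leIl.
Qed.

Lemma meet_clo_le x y : alg_int x `&` clo y <= clo (x `&` y).
Proof.
by rewrite -leC complI compl_clo compl_int -compl_int complI;
  rewrite ?compl_int ?compl_clo ?complI int_join_le.
Qed.

(** By [int_join_le] the left side is at most [clo p \/ int a], and [int a]
is absorbed by [p]; so it lies below [int (clo p)]. *)
Lemma int_interval p q a :
    alg_int a <= p -> alg_int (clo p) <= alg_int p ->
  alg_int (p `|` (q `&` a)) = alg_int p.
Proof.
move=> ap pp; apply/le_anti/andP; split; last by rewrite int_mono // leUl.
apply: le_trans pp; rewrite -[leLHS]int_int int_mono //.
apply: le_trans (int_join_le _ _) _; rewrite leUx lexx /=.
by apply: le_trans (le_clo p); apply: le_trans ap; rewrite int_mono // leIr.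
Qed.

Lemma clo_interval p q a :
    p <= q -> q <= clo a -> clo q <= clo (alg_int q) ->
  clo (p `|` (q `&` a)) = clo q.
Proof.
move=> pq qa qq; apply/le_anti/andP; split.
  by rewrite clo_mono // leUx pq leIl.
apply: le_trans qq _; rewrite -[leRHS]clo_clo clo_mono //.
apply: le_trans (_ : alg_int q `&` clo a <= _).
  by rewrite lexI lexx (le_trans (int_le q)).
by apply: le_trans (meet_clo_le _ _) _; rewrite clo_mono // leUr.
Qed.

End ClosureAlgebraTheory.

(** * The lattice generated by the seven Kuratowski sets *)

(** The names give the element: [Liki] stands for [i k i a], while [Lcap] and
[Lcup] stand for the meet and the join of [k i a] and [i k a]. *)
Variant level := Li | Liki | Lcap | Lki | Lik | Lcup | Lkik | Lk.

Definition level_index (l : level) : nat :=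
  match l with
  | Li => 0 | Liki => 1 | Lcap => 2 | Lki => 3
  | Lik => 4 | Lcup => 5 | Lkik => 6 | Lk => 7
  end.

Lemma level_indexK :
  cancel level_index (nth Lk [:: Li; Liki; Lcap; Lki; Lik; Lcup; Lkik; Lk]).
Proof. by case. Qed.

HB.instance Definition _ := Equality.copy level (can_type level_indexK).

Definition level_rank (l : level) : nat :=
  match l with
  | Li => 0 | Liki => 1 | Lcap => 2 | Lki | Lik => 3
  | Lcup => 4 | Lkik => 5 | Lk => 6
  end.

(** The levels of equal rank are [Lki] and [Lik]; any others are
comparable. *)
Definition level_le (p q : level) : bool :=
  (p == q) || (level_rank p < level_rank q).

Definition level_meet p q :=
  if level_le p q then p else if level_le q p then q else Lcap.

Definition level_join p q :=
  if level_le p q then q else if level_le q p then p else Lcup.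

Definition level_int (l : level) : level :=
  match l with
  | Li => Li
  | Liki | Lcap | Lki => Liki
  | Lik | Lcup | Lkik | Lk => Lik
  end.

Definition level_clo (l : level) : level :=
  match l with
  | Li | Liki | Lcap | Lki => Lki
  | Lik | Lcup | Lkik => Lkik
  | Lk => Lk
  end.

(** Complementation leads out of the intervals; the identity is a
placeholder. *)
Definition interval_ops : op_system (level * level) := OpSystem
  (fun x => (level_clo x.2, level_clo x.2))
  (fun x => (level_int x.1, level_int x.1))
  id
  (fun x y => (level_meet x.1 y.1, level_meet x.2 y.2))
  (fun x y => (level_join x.1 y.1, level_join x.2 y.2)).

Definition interval_le (x : level * level) : bool := level_le x.1 x.2.

Lemma interval_le_closed I : op_closed interval_ops I [set` interval_le].
Proof.
split=> _ => [[p q]|[p q]|[p q]|[p q] [p' q']|[p q] [p' q']];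
  rewrite /= /in_mem /interval_le /=.
- by rewrite /level_le eqxx.
- by rewrite /level_le eqxx.
- by [].
- by case: p; case: q => // _; case: p'; case: q'.
- by case: p; case: q => // _; case: p'; case: q'.
Qed.

Section IntervalValue.
Context d (A : closureAlgType d) (a : A).
Local Open Scope order_scope.

Definition level_val (l : level) : A :=
  match l with
  | Li => alg_int a
  | Liki => alg_int (clo (alg_int a))
  | Lcap => clo (alg_int a) `&` alg_int (clo a)
  | Lki => clo (alg_int a)
  | Lik => alg_int (clo a)
  | Lcup => clo (alg_int a) `|` alg_int (clo a)
  | Lkik => clo (alg_int (clo a))
  | Lk => clo a
  end.

(** Consecutive ranks are compared directly, and the rest by climbing through a
level of each intermediate rank. *)
Lemma level_val_le p q : level_le p q -> level_val p <= level_val q.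
Proof.
case/predU1P => [-> //|].
have cover p' q' : level_rank q' = (level_rank p').+1 ->
    level_val p' <= level_val q'.
  case: p'; case: q' => //= _; rewrite ?leIl ?leIr ?leUl ?leUr //.
  - by rewrite -{1}int_int int_mono // le_clo.
  - by rewrite lexI int_le int_mono // clo_mono // int_le.
  - by rewrite leUx le_clo clo_mono // int_mono // le_clo.
  - by rewrite -{2}[clo a]clo_clo clo_mono // int_le.
have below n : (n < 6)%N -> exists r, level_rank r = n.
  by case: n => [|[|[|[|[|[]]]]]] // _;
    [exists Li|exists Liki|exists Lcap|exists Lki|exists Lcup|exists Lkik].
have rank6 (r : level) : (level_rank r < 7)%N by case: r.
suff climb n r : level_rank r = n -> (level_rank p < n)%N ->
    level_val p <= level_val r by exact: climb.
elim: n r => // n IHn r rn.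
rewrite ltnS leq_eqVlt => /predU1P[pn|pn]; first by apply: cover; rewrite rn pn.
have [s sn] : exists s, level_rank s = n.
  by apply: below; have := rank6 r; rewrite rn.
by apply: le_trans (IHn s sn pn) (cover _ _ _); rewrite sn.
Qed.

Lemma level_val_meet p q :
  level_val (level_meet p q) = level_val p `&` level_val q.
Proof.
rewrite /level_meet; case: ifP => [/level_val_le/meet_l -> //|].
case: ifP => [/level_val_le/meet_r -> //|].
by case: p; case: q => //; rewrite meetC.
Qed.

Lemma level_val_join p q :
  level_val (level_join p q) = level_val p `|` level_val q.
Proof.
rewrite /level_join; case: ifP => [/level_val_le/join_r -> //|].
case: ifP => [/level_val_le/join_l -> //|].
by case: p; case: q => //; rewrite joinC.
Qed.

Lemma level_val_int p : level_val (level_int p) = alg_int (level_val p).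
Proof.
case: p => /=; rewrite ?intI ?int_int ?int_clo_int_clo //.
  by rewrite meet_l // (@level_val_le Liki Lik).
apply/le_anti/andP; split; first by rewrite -[leLHS]int_int int_mono // leUr.
by rewrite -[leRHS]int_clo_int_clo int_mono // (@level_val_le Lcup Lkik).
Qed.

Lemma level_val_clo p : level_val (level_clo p) = clo (level_val p).
Proof.
case: p => /=; rewrite -?cloU ?clo_clo ?clo_int_clo_int //.
  apply/le_anti/andP; split; last by rewrite -[leRHS]clo_clo clo_mono // leIl.
  by rewrite -[leLHS]clo_int_clo_int clo_mono // (@level_val_le Liki Lcap).
by rewrite join_r // (@level_val_le Lki Lkik).
Qed.

Definition interval_val (x : level * level) : A :=
  level_val x.1 `|` (level_val x.2 `&` a).

Lemma interval_val_gen : interval_val (Li, Lk) = a.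
Proof. by rewrite /interval_val /= (meet_r (le_clo a)) (join_r (int_le a)). Qed.

Lemma interval_val_diag l : interval_val (l, l) = level_val l.
Proof. by rewrite /interval_val /= meetKU. Qed.

(** Of the four terms of the expanded right side, the mixed ones
[p /\ q' /\ a] and [q /\ p' /\ a] are absorbed by [q /\ q' /\ a]. *)
Lemma interval_val_meet x y : interval_le x -> interval_le y ->
  interval_val (op_meet interval_ops x y) = interval_val x `&` interval_val y.
Proof.
case: x y => [p q] [p' q'] /level_val_le /= pq /level_val_le /= pq'.
rewrite /interval_val /= !level_val_meet.
set P := level_val p in pq *; set Q := level_val q in pq *.
set P' := level_val p' in pq' *; set Q' := level_val q' in pq' *.
rewrite meetUl !meetUr; apply/le_anti/andP; split.
  rewrite leUx; apply/andP; split; first by rewrite -!joinA leUl.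
  rewrite lexU2 //; apply/orP; right; rewrite lexU2 //; apply/orP; right.
  by rewrite -{1}[a]meetxx meetACA.
rewrite !leUx leUl /=; apply/and3P; split.
- by rewrite lexU2 //; apply/orP; right; rewrite meetA leI2 // leI2.
- rewrite lexU2 //; apply/orP; right.
  by rewrite meetAC leI2 // leI2.
- by rewrite lexU2 //; apply/orP; right; rewrite meetACA meetxx.
Qed.

Lemma interval_val_join x y :
  interval_val (op_join interval_ops x y) = interval_val x `|` interval_val y.
Proof. by rewrite /interval_val /= !level_val_join meetUl joinACA. Qed.

(** Every level [p] but the lowest satisfies [i k p <= i p], so that
[int_interval] applies. *)
Lemma interval_val_int x : interval_le x ->
  interval_val (op_i interval_ops x) = alg_int (interval_val x).
Proof.
case: x => p q _; rewrite interval_val_diag /= level_val_int /interval_val /=.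
have [->|np] := eqVneq p Li.
  rewrite /= int_int; apply/le_anti/andP; split.
    by rewrite -{1}int_int int_mono // leUl.
  by rewrite int_mono // leUx int_le leIr.
rewrite int_interval //; first by apply: (@level_val_le Li); case: p {np}.
rewrite -level_val_clo -!level_val_int level_val_le //.
by case: p np.
Qed.

(** Every level [q] but the highest satisfies [k q <= k i q], so that
[clo_interval] applies. *)
Lemma interval_val_clo x : interval_le x ->
  interval_val (op_k interval_ops x) = clo (interval_val x).
Proof.
case: x => p q pq; rewrite interval_val_diag /= level_val_clo /interval_val /=.
have [->|nq] := eqVneq q Lk.
  rewrite /= clo_clo (meet_r (le_clo a)) -cloU -level_val_clo.
  by rewrite join_r // (@level_val_le _ Lk); case: p {pq}.
rewrite clo_interval //; first exact: level_val_le.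
  by apply: (@level_val_le _ Lk); case: q {pq nq}.
rewrite -level_val_int -!level_val_clo level_val_le //.
by case: q nq {pq}.
Qed.

End IntervalValue.

(** * The sets generated in the presence of complements *)

(** A pair [(b, x)] denotes [x], complemented if [b] holds; complementing
exchanges closure and interior.  Meets and joins of signed codes are in general
not signed codes, and the last two operations are placeholders. *)
Definition signed_ops T (P : op_system T) : op_system (bool * T) := OpSystem
  (fun x => (x.1, (if x.1 then op_i P else op_k P) x.2))
  (fun x => (x.1, (if x.1 then op_k P else op_i P) x.2))
  (fun x => (~~ x.1, x.2))
  (fun x _ => x) (fun x _ => x).

Definition signed_val d (A : closureAlgType d) T (v : T -> A)
    (x : bool * T) : A :=
  (if x.1 then ~` v x.2 else v x.2)%O.

(** A pair gives the truth values of a Boolean expression in [a] on [a] and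
off [a].  The first two operations are placeholders. *)
Definition truth_ops : op_system (bool * bool) := OpSystem
  id id
  (fun x => (~~ x.1, ~~ x.2))
  (fun x y => (x.1 && y.1, x.2 && y.2))
  (fun x y => (x.1 || y.1, x.2 || y.2)).

Definition truth_val d (A : closureAlgType d) (a : A) (x : bool * bool) : A :=
  match x with
  | (true, true) => \top | (true, false) => a
  | (false, true) => ~` a | (false, false) => \bot
  end%O.

Lemma interval_val_morphism k i m j d (A : closureAlgType d) (a : A) :
  let I := [set o | opset k i false m j o] in
  op_morphism_on interval_ops (alg_ops A) I
    (generated interval_ops I (Li, Lk)) (interval_val a).
Proof.
move=> I; have sub : generated interval_ops I (Li, Lk) `<=` [set` interval_le].
  by apply: generated_min => //; exact: interval_le_closed.
split=> // [_ x /sub|_ x /sub|_ x y /sub + /sub|_ x y _ _].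
- exact: interval_val_clo.
- exact: interval_val_int.
- exact: interval_val_meet.
- exact: interval_val_join.
Qed.

Lemma signed_val_morphism k i d (A : closureAlgType d) (a : A) :
  let I := [set o | opset k i true false false o] in
  op_morphism_on (signed_ops interval_ops) (alg_ops A) I
    (generated (signed_ops interval_ops) I (false, (Li, Lk)))
    (signed_val (interval_val a)).
Proof.
move=> I.
have sub : generated (signed_ops interval_ops) I (false, (Li, Lk)) `<=`
    [set x | interval_le x.2].
  apply: generated_min => //; have cl := interval_le_closed setT.
  by split=> //= _ [[] x] /=; (exact: (closed_k cl) || exact: (closed_i cl)).
split=> // _ [[] x] /sub /= lex; rewrite /signed_val /=.
- by rewrite interval_val_int // compl_int.
- by rewrite interval_val_clo.
- by rewrite interval_val_clo // compl_clo.
- by rewrite interval_val_int.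
- by rewrite complK.
- by [].
Qed.

Lemma truth_val_morphism c m j d (A : closureAlgType d) (a : A) S :
  op_morphism_on truth_ops (alg_ops A) [set o | opset false false c m j o] S
    (truth_val a).
Proof.
split=> // _ => [[[] []] _|[[] []] [[] []] _ _|[[] []] [[] []] _ _] /=;
  by rewrite ?(meetxx, meetx1, meet1x, meetx0, meet0x, meetxC, meetCx)
    ?(joinxx, joinx1, join1x, joinx0, join0x, joinxC, joinCx)
    ?(compl0, compl1, complK).
Qed.

(** * Upper bounds *)

(** The table of values, as a function of the available operations. *)
Definition max_gen (k i c m j : bool) : ecard :=
  if c then
    if k || i then if m || j then Infty else 14
    else if m || j then 4 else 2
  else if k && i then if m && j then 35 else if m || j then 13 else 7
  else if k || i then 2 else 1.

(** [N] bounds the number of rounds; ten rounds are enough for all families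
below, whose longest derivations are alternating words in complement and one
of closure and interior. *)
Definition saturates_to (T : eqType) (P : op_system T) J N x n : bool :=
  let s := saturation P J N x in
  all [in s] (saturation_step P J s) && (size s == n).

Lemma saturates_card_le (T : eqType) (P : op_system T)
    (J : pred operation) N x n d (A : closureAlgType d) (h : T -> A) :
  let I := [set o | J o] in
  saturates_to P J N x n ->
  op_morphism_on P (alg_ops A) I (generated P I x) h ->
  alg_gen I (h x) #<= `I_n.
Proof.
move=> I /andP[sat /eqP <-] hm.
rewrite alg_genE (generated_image hm) (generated_saturation sat).
exact: card_le_trans (card_image_le _ _) (card_le_seq _).
Qed.

(** Three kinds of codes cover the finite entries: intervals when there is no
complement, signed intervals when there is one with interior or closure, truth
tables when it comes with neither. *)
Lemma max_gen_upper k i c m j n : max_gen k i c m j = Fin n ->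
  forall d (A : closureAlgType d) (a : A),
    alg_gen [set o | opset k i c m j o] a #<= `I_n.
Proof.
move=> En d A a; case: c En => En; last first.
  rewrite -{1}(interval_val_gen a).
  apply: (@saturates_card_le _ _ _ 10); last first.
    exact: interval_val_morphism.
  by case: k En; case: i; case: m; case: j => -[<-]; vm_compute.
have [ki|nki] := boolP (k || i).
  move: En; rewrite /max_gen ki; case: m => //; case: j => //= -[<-].
  have {1}-> : a = signed_val (interval_val a) (false, (Li, Lk)).
    by rewrite /signed_val /= interval_val_gen.
  apply: (@saturates_card_le _ _ _ 10); last exact: signed_val_morphism.
  by case: k ki; case: i => // _; vm_compute.
case: k nki En => //; case: i => //= _ En.
have {1}-> : a = truth_val a (true, false) by [].
apply: (@saturates_card_le _ _ _ 10); last exact: truth_val_morphism.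
by case: m En; case: j => -[<-]; vm_compute.
Qed.

(** * Alexandrov topologies *)

Record preorder_on (T : Type) (r : T -> T -> Prop) : Prop := PreorderOn {
  preorder_refl : forall x, r x x;
  preorder_trans : forall y x z, r x y -> r y z -> r x z }.

(** The preorder proof is a parameter of the carrier, since the topology
depends on it. *)
Definition alexandrov (T : choiceType) (r : T -> T -> Prop)
  & preorder_on r : Type := T.

Section Alexandrov.
Variables (T : choiceType) (r : T -> T -> Prop) (rP : preorder_on r).
Local Notation X := (alexandrov rP).

Definition up_nbhs (x : X) : set_system X := [set A | forall y, r x y -> A y].

Definition up_open : set_system X := [set A | forall x, A x -> up_nbhs x A].

Fact up_nbhs_filter x : ProperFilter (up_nbhs x).
Proof.
split; first by move=> /(_ x (preorder_refl rP x)).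
split=> //; first by move=> A B nA nB y xy; split; [exact: nA | exact: nB].
by move=> A B AB nA y /nA/AB.
Qed.

Fact up_nbhsE x : up_nbhs x =
  [set A | exists B, [/\ up_open B, B x & B `<=` A]].
Proof.
apply/seteqP; split=> A /=; last by move=> [B [oB Bx BA]] y /(oB _ Bx)/BA.
move=> nA; exists (r x); split=> //; last exact: preorder_refl.
by move=> y xy z; exact: preorder_trans xy.
Qed.

HB.instance Definition _ := Choice.on X.
HB.instance Definition _ := hasNbhs.Build X up_nbhs.
HB.instance Definition _ :=
  Nbhs_isTopological.Build X up_nbhs_filter up_nbhsE erefl.

Lemma alexandrov_closure (A : set X) :
  closure A = [set x | exists2 y, r x y & A y].
Proof.
apply/seteqP; split=> x /=.
  by move=> /(_ (r x)) []// y [Ay xy]; exists y.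
by move=> [y xy Ay] B nB; exists y; split=> //; exact: nB.
Qed.

End Alexandrov.

(** * A finite space attaining the bounds *)

(** The least neighbourhood of each point.  The minimal neighbourhoods are the
open point 0 (in the set [E]), the open point 1 (outside) and the open
indiscrete pair 2, 3, of which only 2 is in [E]; this pair lies in [i k E] but
not in [k i E]. The other points come in pairs as well, one in [E] and one not:
4, 5 lie in [i k i E] but not in [i E]; 6, 7 in [k i E /\ i k E] but not in [i
k i E]; 8, 9 in [k i E] but not in [i k E]; 10, 11 in [k i k E] but in neither
[k i E] nor [i k E]; 12, 13 in [k E] but not in [k i k E]. *)
Definition up_points (x : nat) : seq nat := nth [::]
  [:: [:: 0]; [:: 1]; [:: 2; 3]; [:: 2; 3];
      [:: 4; 0]; [:: 5; 4; 0];
      [:: 6; 0; 2; 3]; [:: 7; 0; 2; 3];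
      [:: 8; 0; 1]; [:: 9; 0; 1];
      [:: 10; 1; 2; 3]; [:: 11; 1; 2; 3];
      [:: 12; 1]; [:: 13; 12; 1]] x.

Lemma up_points_lt x y : (x < 14)%N -> y \in up_points x -> (y < 14)%N.
Proof.
have /allP H : all (fun x => all (fun y => y < 14)%N (up_points x)) (iota 0 14).
  by vm_compute.
by move=> x14; have /H /allP : x \in iota 0 14; [rewrite mem_iota | apply].
Qed.

Definition point_le (x y : 'I_14) : Prop := (y : nat) \in up_points x.

Lemma point_le_preorder : preorder_on point_le.
Proof.
split=> [x|y x z]; rewrite /point_le.
  have /allP : all (fun x => x \in up_points x) (iota 0 14) by [].
  by apply; rewrite mem_iota /=.
have /allP H : all (fun x =>
    all (fun y => all [in up_points x] (up_points y)) (up_points x))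
  (iota 0 14).
  by vm_compute.
have /H /allP {}H : (x : nat) \in iota 0 14 by rewrite mem_iota /=.
by move=> /H /allP {}H /H.
Qed.

(** Subsets of the space as lists of 14 bits, with the operations computed from
the least neighbourhoods. *)
Definition bit_ops : op_system (seq bool) := OpSystem
  (fun s => mkseq (fun x => has (nth false s) (up_points x)) 14)
  (fun s => mkseq (fun x => all (nth false s) (up_points x)) 14)
  (fun s => mkseq (fun x => ~~ nth false s x) 14)
  (fun s t => mkseq (fun x => nth false s x && nth false t x) 14)
  (fun s t => mkseq (fun x => nth false s x || nth false t x) 14).

Definition bit_gen : seq bool :=
  mkseq [in [:: 0; 2; 5; 6; 8; 10; 12]] 14.

Definition bit_set (s : seq bool) : set (alexandrov point_le_preorder) :=
  [set x : 'I_14 | nth false s x].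

Lemma bit_set_clo s : bit_set (op_k bit_ops s) = closure (bit_set s).
Proof.
rewrite alexandrov_closure; apply/funext => x; apply/propext.
rewrite /bit_set /= nth_mkseq //; split.
  move=> /hasP[y xy sy].
  by exists (Ordinal (up_points_lt (ltn_ord x) xy)).
by move=> [y xy sy]; apply/hasP; exists (y : nat).
Qed.

Lemma bit_set_compl s : bit_set (op_c bit_ops s) = ~` bit_set s.
Proof.
apply/funext => x; apply/propext; rewrite /bit_set /= nth_mkseq //.
by split=> /negP.
Qed.

Lemma bit_set_morphism I S :
  op_morphism_on bit_ops (alg_ops (set (alexandrov point_le_preorder)))
    I S bit_set.
Proof.
split=> _ => [s _|s _|s _|s t _ _|s t _ _].
- exact: bit_set_clo.
- have -> : op_i bit_ops s = op_c bit_ops (op_k bit_ops (op_c bit_ops s)).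
    apply/eq_in_map => x; rewrite mem_iota /= => x14.
    rewrite nth_mkseq // -all_predC; apply: eq_in_all => y xy /=.
    by rewrite nth_mkseq ?negbK // (up_points_lt x14 xy).
  by rewrite bit_set_compl bit_set_clo bit_set_compl.
- exact: bit_set_compl.
- apply/funext => x; apply/propext; rewrite /bit_set /= nth_mkseq //.
  by split=> /andP.
- apply/funext => x; apply/propext; rewrite /bit_set /= nth_mkseq //.
  by split=> /orP.
Qed.

Lemma bit_set_inj : {in [set s | size s = 14] &, injective bit_set}.
Proof.
move=> s t /set_mem /= ss /set_mem /= st E.
apply: (@eq_from_nth _ false) => [|x]; first by rewrite ss st.
rewrite ss => x14; have : bit_set s (Ordinal x14) = bit_set t (Ordinal x14).
  by rewrite E.
by rewrite /bit_set /= => /is_true_inj.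
Qed.

Lemma max_gen_attained k i c m j n : max_gen k i c m j = Fin n ->
  top_gen [set o | opset k i c m j o] (bit_set bit_gen) #= `I_n.
Proof.
move=> En; have : saturates_to bit_ops (opset k i c m j) 10 bit_gen n.
  by case: k En; case: i; case: c; case: m; case: j => En;
    (discriminate || (case: En => <-; vm_compute; reflexivity)).
move=> /andP[sat /eqP <-]; set I := [set o | opset k i c m j o].
rewrite top_genE (generated_image (bit_set_morphism _ _)).
have sub : generated bit_ops I bit_gen `<=` [set s | size s = 14].
  by apply: generated_min => //; split=> *; exact: size_mkseq.
rewrite (card_eql (inj_card_eq _)).
  by rewrite (generated_saturation sat) card_eq_seq // uniq_saturation.
move=> s t /set_mem /sub ss /set_mem /sub st.
by apply: bit_set_inj; exact/mem_set.
Qed.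

(** * Infinitely many sets *)

Lemma geq_preorder : preorder_on (fun x y : nat => (y <= x)%N).
Proof. by split=> [x|y x z yx zy]; [exact: leqnn | exact: leq_trans zy yx]. Qed.

Definition odd_set : set (alexandrov geq_preorder) := [set x : nat | odd x].

Definition tail (n : nat) : set (alexandrov geq_preorder) :=
  [set x : nat | (n <= x)%N].

(** Conjugation by complement exchanges closure with interior and meet with
join. *)
Lemma op_closed_all d (A : closureAlgType d) (I : set operation) (S : set A) :
  I Op_c -> I Op_k \/ I Op_i -> I Op_meet \/ I Op_join ->
  op_closed (alg_ops A) I S -> op_closed (alg_ops A) setT S.
Proof.
move=> Ic Iki Imj cS.
have Sc x : S x -> S (~` x)%O := closed_c cS Ic (x := x).
have Sk x : S x -> S (clo x).
  case: Iki => [Ik|Ii]; first exact: (closed_k cS Ik).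
  by move=> /Sc /(closed_i cS Ii) /Sc /=; rewrite -compl_clo complK.
have Sm x y : S x -> S y -> S (x `&` y)%O.
  case: Imj => [Im|Ij]; first exact: (closed_meet cS Im).
  by move=> /Sc Sx /Sc Sy; have /Sc := closed_join cS Ij Sx Sy;
    rewrite complU !complK.
split=> // _ => [x /Sc/Sk/Sc //|x y /Sc Sx /Sc Sy].
by have /Sc := Sm _ _ Sx Sy; rewrite complI !complK.
Qed.

Lemma closure_of_least (A : set (alexandrov geq_preorder)) (n : nat) :
  A n -> (forall x : nat, A x -> (n <= x)%N) -> closure A = tail n.
Proof.
move=> An nA; rewrite alexandrov_closure; apply/seteqP; split=> x /=.
  by move=> [y yx /nA ny]; exact: leq_trans ny yx.
by move=> nx; exists n.
Qed.

(** By induction: the closure of the elements of [[n, oo)] of parity opposite to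
[n] is [[n + 1, oo)], as [n + 1] is the least of them. *)
Lemma tails_generated n :
  generated (alg_ops (set (alexandrov geq_preorder))) setT odd_set (tail n).
Proof.
set G := generated _ _ _.
have cG : op_closed _ setT G := generated_closed _ _ _.
have GE : G odd_set := generated_self _ _ _.
have GcE : G (~` odd_set) := closed_c cG I GE.
elim: n => [|n IHn].
  have -> : tail 0 = odd_set `|` ~` odd_set.
    by rewrite setUv; apply/seteqP.
  exact: (closed_join cG I GE GcE).
pose D : set (alexandrov geq_preorder) :=
  if odd n then ~` odd_set else odd_set.
have GD : G D by rewrite /D; case: ifP.
have Dn (x : nat) : D x = (odd x != odd n) :> Prop.
  rewrite /D /odd_set; case: (odd n) => /=; apply/propext.
    by rewrite /setC /=; split; case: (odd x).
  by case: (odd x).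
have <- : closure (tail n `&` D) = tail n.+1.
  apply: closure_of_least => [|x [/= nx]].
    by split; rewrite ?Dn /=; [exact: leqnSn | case: (odd n)].
  by rewrite Dn => xn; rewrite ltn_neqAle nx andbT; apply: contraNneq xn => ->.
exact: (closed_k cG I (closed_meet cG I IHn GD)).
Qed.

Lemma infinite_top_gen (I : set operation) :
  I Op_c -> I Op_k \/ I Op_i -> I Op_meet \/ I Op_join ->
  infinite_set (top_gen I odd_set).
Proof.
move=> Ic Iki Imj; apply/infiniteP.
have inj : {in [set: nat] &, injective tail}.
  move=> m n _ _ E; apply/anti_leq/andP; split.
    by have := leqnn n : tail n n; rewrite -E; apply.
  by have := leqnn m : tail m m; rewrite E; apply.
have := inj_card_eq inj; rewrite card_eq_le => /andP[_ le].
apply: card_le_trans le _; apply: subset_card_le => _ [n _ <-].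
rewrite top_genE; apply: generated_min (tails_generated n);
  last exact: generated_self.
exact: op_closed_all (generated_closed _ _ _).
Qed.

(** * Transfer to the free closure algebra and assembly *)

Lemma clo_hom_morphism I d1 (A : closureAlgType d1) d2 (B : closureAlgType d2)
    (h : A -> B) S :
  is_closure_hom h -> op_morphism_on (alg_ops A) (alg_ops B) I S h.
Proof.
move=> hh; split=> _ *.
- exact: hom_clo hh _.
- by rewrite /= /alg_int (hom_compl hh) (hom_clo hh) (hom_compl hh).
- exact: hom_compl hh _.
- exact: hom_meet hh _ _.
- exact: hom_join hh _ _.
Qed.

(** The homomorphism that sends [f] to [E] maps the elements generated by [f]
onto the sets generated by [E]. *)
Lemma free_gen_ge d (F : closureAlgType d) (f : F) (X : topologicalType)
    (E : set X) I :
  is_free1 f -> top_gen I E #<= alg_gen I f.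
Proof.
move=> /(_ _ _ E)[h [[hh <-] _]].
rewrite top_genE (generated_image (clo_hom_morphism _ _ hh)).
exact: card_image_le.
Qed.

Lemma max_gen_infinite k i c m j : max_gen k i c m j = Infty ->
  [/\ c, k || i & m || j].
Proof. by case: k; case: i; case: c; case: m; case: j. Qed.

(** The free algebra satisfies the upper bound as a closure algebra, and the
lower bound because it maps onto the sets generated in the extremal space. *)
Lemma max_genP k i c m j (I : set operation) :
    (forall o, I o <-> opset k i c m j o) ->
  is_max_gen I (max_gen k i c m j) /\
  forall d (F : closureAlgType d) (f : F), is_free1 f ->
    has_ecard (alg_gen I f) (max_gen k i c m j).
Proof.
move=> IE; have {IE}-> : I = [set o | opset k i c m j o].
  by apply/funext => o; apply/propext.
case En: (max_gen k i c m j) => [n|].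
- have upper := max_gen_upper En; have attained := max_gen_attained En.
  split; first split.
  + by move=> X E; rewrite top_genE; exact: upper.
  + by exists (alexandrov point_le_preorder), (bit_set bit_gen).
  + move=> d F f ff; rewrite /= card_eq_le upper.
    by rewrite -(card_le_eql attained) free_gen_ge.
- have [c1 ki mj] := max_gen_infinite En.
  have inf : infinite_set (top_gen [set o | opset k i c m j o] odd_set).
    by apply: infinite_top_gen => //=; exact/orP.
  split=> [|d F f ff]; first by exists (alexandrov geq_preorder), odd_set.
  move/infiniteP: inf => inf; apply/infiniteP.
  exact: card_le_trans inf (free_gen_ge _ _ ff).
Qed.

Lemma opset_surj (I : set operation) :
  exists k i c m j, forall o, I o <-> opset k i c m j o.
Proof.
exists `[<I Op_k>], `[<I Op_i>], `[<I Op_c>], `[<I Op_meet>], `[<I Op_join>].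
by case; split=> /asboolP.
Qed.

(** An entry is an instance of [max_genP], once its set of operations is matched
with the five truth values. *)
Ltac row k i c :=
  split;
  [ apply: (proj1 (@max_genP k i c false false _ _))
  | apply: (proj1 (@max_genP k i c true false _ _))
  | apply: (proj1 (@max_genP k i c false true _ _))
  | apply: (proj1 (@max_genP k i c true true _ _)) ];
  by case; split=> //=; intuition.

Theorem mainTheorem1 :
  [/\ (forall (d : Order.disp_t) (F : closureAlgType d) (f : F),
         is_free1 f ->
         forall I : set operation,
           exists m : ecard, is_max_gen I m /\ has_ecard (alg_gen I f) m),
      [/\ table_row set0 1 1 1 1,
          table_row [set Op_i] 2 2 2 2,
          table_row [set Op_k] 2 2 2 2 &
          table_row [set Op_c] 2 4 4 4],
      [/\ table_row [set Op_i; Op_k] 7 13 13 35,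
          table_row [set Op_i; Op_c] 14 Infty Infty Infty,
          table_row [set Op_k; Op_c] 14 Infty Infty Infty &
          table_row [set Op_i; Op_k; Op_c] 14 Infty Infty Infty],
      is_max_gen [set Op_k; Op_i; Op_meet] 13 &
      is_max_gen [set Op_k; Op_i; Op_meet; Op_join] 35].
Proof.
split.
- move=> d F f ff I; have [k [i [c [m [j IE]]]]] := opset_surj I.
  have [maxI freeI] := max_genP IE.
  by exists (max_gen k i c m j); split=> //; exact: freeI.
- split; [row false false false | row false true false
         | row true false false | row false false true].
- split; [row true true false | row false true true
         | row true false true | row true true true].
- apply: (proj1 (@max_genP true true false true false _ _)).
  by case; split=> //=; intuition.
- apply: (proj1 (@max_genP true true false true true _ _)).
  by case; split=> //=; intuition.
Qed.
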